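(* Let $X,Y$ be maximal Gromov hyperbolic spaces (whose visual boundaries have at least four points), and let $f:\partial X\to\partial Y$ be a Moebius homeomorphism. Then $f$ extends to an isometry (distance-preserving bijection) $F:X\to Y$, i.e. there is an isometry $F:X\to Y$ such that the map $\overline X\to\overline Y$ equal to $F$ on $X$ and to $f$ on $\partial X$ is continuous.
   Context: $(y|z)_x=\frac12(d(x,y)+d(x,z)-d(y,z))$ is the Gromov product. For a proper geodesic Gromov hyperbolic space $X$, $\partial X$ is its visual (Gromov) boundary and $\overline X=X\cup\partial X$ its visual compactification. $X$ is boundary continuous if for each $x\in X$ the Gromov product $(\cdot|\cdot)_x$ extends to a continuous function $\overline X\times\overline X\to[0,+\infty]$; then $\rho_x(\xi,\eta)=e^{-(\xi|\eta)_x}$ for $\xi,\eta\in\partial X$. The cross-ratio $[\xi,\xi',\eta,\eta']_{\rho_x}=\frac{\rho_x(\xi,\eta)\rho_x(\xi',\eta')}{\rho_x(\xi,\eta')\rho_x(\xi',\eta)}$ of quadruples of distinct points of $\partial X$ does not depend on $x$. A map between boundaries of such spaces is Moebius if it preserves these cross-ratios on all quadruples of distinct points. A space is geodesically complete if every geodesic segment extends to a bi-infinite geodesic. A proper, geodesic, geodesically complete, boundary continuous Gromov hyperbolic space $X$ is a maximal Gromov hyperbolic space if for every proper, geodesic, geodesically complete, boundary continuous Gromov hyperbolic space $Y$ and every Moebius homeomorphism $g:\partial Y\to\partial X$, there is an isometric (distance-preserving) embedding $G:Y\to X$ extending $g$, meaning that the map $\overline Y\to\overline X$ equal to $G$ on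 $Y$ and $g$ on $\partial Y$ is continuous. *)

(* Defs.v *)
From HB Require Import structures.
From mathcomp Require Import all_boot all_order all_algebra.
From mathcomp Require Import all_classical all_reals all_analysis.

Set Implicit Arguments.
Unset Strict Implicit.
Unset Printing Implicit Defensive.

Import Order.TTheory GRing.Theory Num.Theory.
Import numFieldNormedType.Exports.

Local Open Scope classical_set_scope.
Local Open Scope ring_scope.
Local Open Scope quotient_scope.

Section MetricNotions.
Context {R : realType}.

Definition isometric_on (X : metricType R) (I : set R) (c : R -> X) : Prop :=
  forall s t, I s -> I t -> mdist (c s) (c t) = `|s - t|.

Definition isometric_embedding (X Y : metricType R) (F : X -> Y) : Prop :=
  forall x x', mdist (F x) (F x') = mdist x x'.

Definition proper_space (X : metricType R) : Prop :=
  forall (x : X) (r : R), compact [set y | mdist x y <= r].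

Definition geodesic_space (X : metricType R) : Prop :=
  forall x y : X, exists c : R -> X,
    [/\ isometric_on `[0, mdist x y] c, c 0 = x & c (mdist x y) = y].

Definition geodesically_complete (X : metricType R) : Prop :=
  forall (a b : R) (c : R -> X), a <= b -> isometric_on `[a, b] c ->
    exists2 c' : R -> X, isometric_on setT c' & {in `[a, b], c' =1 c}.

Definition gromov_product (X : metricType R) (x y z : X) : R :=
  (mdist x y + mdist x z - mdist y z) / 2.

Definition gromov_hyperbolic (X : metricType R) : Prop :=
  exists2 delta : R, 0 <= delta & forall x y z w : X,
    Num.min (gromov_product x y w) (gromov_product x w z) - delta
      <= gromov_product x y z.

End MetricNotions.

Section Rays.
Context {R : realType} (X : metricType R).

(* Only the restriction of [ray_fun] to [0, +oo[ matters: [asymptotic] below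
   does not see the values at negative reals. *)
Record ray : Type := Ray {
  ray_fun :> R -> X;
  ray_isometric : isometric_on `[0, +oo[ ray_fun }.

HB.instance Definition _ := gen_eqMixin ray.
HB.instance Definition _ := gen_choiceMixin ray.

Definition asymptotic (c c' : ray) : bool :=
  `[< exists M : R, forall t, 0 <= t -> mdist (c t) (c' t) <= M >].

Lemma asymptotic_refl : reflexive asymptotic.
Proof. by move=> c; apply/asboolP; exists 0 => t _; rewrite mdistxx. Qed.

Lemma asymptotic_sym : symmetric asymptotic.
Proof.
by move=> c c'; apply/asboolP/asboolP => -[M cM]; exists M => t t0;
  rewrite metric_sym cM.
Qed.

Lemma asymptotic_trans : transitive asymptotic.
Proof.
move=> c2 c1 c3 /asboolP[M cM] /asboolP[N cN]; apply/asboolP.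
exists (M + N) => t t0.
by rewrite (le_trans (metric_triangle _ (c2 t) _))// lerD// (cM, cN).
Qed.

Canonical asymptotic_equiv :=
  EquivRel asymptotic asymptotic_refl asymptotic_sym asymptotic_trans.

Definition boundary : Type := {eq_quot asymptotic}.

HB.instance Definition _ := EqQuotient.on boundary.
HB.instance Definition _ := Choice.on boundary.

End Rays.

Section Compactification.
Context {R : realType} (X : metricType R).

Inductive compactification : Type :=
| Interior of X
| Ideal of boundary X.

HB.instance Definition _ := gen_eqMixin compactification.
HB.instance Definition _ := gen_choiceMixin compactification.

(* The standard neighbourhoods U(xi, r) of a boundary point: the points z such
   that (xi | z)_x >= r, where a Gromov product at infinity is a lower limit
   along some geodesic rays in the given classes (in a hyperbolic space, other
   rays change it by a bounded amount only). *)
Definition shadow (x : X) (xi : boundary X) (r : R) : set compactification :=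
  fun z => match z with
  | Interior y => exists2 c : ray X, \pi c = xi &
      \forall t \near +oo, r <= gromov_product x (c t) y
  | Ideal eta => exists c c' : ray X, [/\ \pi c = xi, \pi c' = eta &
      \forall s \near +oo & t \near +oo, r <= gromov_product x (c s) (c' t)]
  end.

(* Changing the base point x moves Gromov products by a bounded amount, so that
   the choice of x is immaterial. *)
Definition compactification_open (U : set compactification) : Prop :=
  (forall x, U (Interior x) -> \forall y \near x, U (Interior y)) /\
  (forall xi, U (Ideal xi) -> forall x, exists r, shadow x xi r `<=` U).

Lemma shadow_le x xi r r' : r <= r' -> shadow x xi r' `<=` shadow x xi r.
Proof.
move=> rr' [y|eta] /=.
  by move=> [c cxi cy]; exists c => //; apply: filterS cy => t; exact: le_trans.
move=> [c [c' [cxi ceta cc']]]; exists c, c'; split => //.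
by apply: filterS cc' => t; exact: le_trans.
Qed.

Lemma compactification_openT : compactification_open setT.
Proof.
by split=> [x _|xi _ x]; [exact: filterT|exists 0; exact: subsetT].
Qed.

Lemma compactification_openI : setI_closed compactification_open.
Proof.
move=> U V [U1 U2] [V1 V2]; split=> [x [Ux Vx]|xi [Uxi Vxi] x].
  by near=> y; split; near: y; [exact: U1|exact: V1].
have [r rU] := U2 _ Uxi x; have [s sV] := V2 _ Vxi x.
exists (Num.max r s) => z zrs; split.
- by apply: rU; apply: shadow_le zrs; rewrite le_max lexx.
- by apply: sV; apply: shadow_le zrs; rewrite le_max lexx orbT.
Unshelve. all: by end_near. Qed.

Lemma compactification_open_bigU (I : Type) (U : I -> set compactification) :
  (forall i, compactification_open (U i)) ->
  compactification_open (\bigcup_i U i).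
Proof.
move=> oU; split=> [x [i _ Ux]|xi [i _ Uxi] x].
  by apply: filterS ((oU i).1 _ Ux) => y Uy; exists i.
by have [r rU] := (oU i).2 _ Uxi x; exists r => z /rU; exists i.
Qed.

HB.instance Definition _ := isOpenTopological.Build compactification
  compactification_openT compactification_openI compactification_open_bigU.

HB.instance Definition _ :=
  Topological.copy (boundary X) (initial_topology Ideal).

End Compactification.

Arguments Interior {R X}.
Arguments Ideal {R X}.

Section Moebius.
Context {R : realType}.

Definition gromov_extension (X : metricType R) (x : X)
    (Phi : compactification X * compactification X -> \bar R) : Prop :=
  [/\ forall y z, Phi (Interior y, Interior z) = (gromov_product x y z)%:E,
      forall p, (0 <= Phi p)%E & continuous Phi].

Definition boundary_continuous (X : metricType R) : Prop :=
  forall x : X, exists Phi, gromov_extension x Phi.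

(* Interior points are dense, so there is at most one [gromov_extension]. *)
Definition extended_gromov_product (X : metricType R) (x : X) :
    compactification X * compactification X -> \bar R :=
  xget (cst 0%E) [set Phi | gromov_extension x Phi].

Definition visual_dist (X : metricType R) (x : X) (xi eta : boundary X) : R :=
  fine (expeR (- extended_gromov_product x (Ideal xi, Ideal eta))%E).

Definition cross_ratio (X : metricType R) (x : X)
    (xi xi' eta eta' : boundary X) : R :=
  (visual_dist x xi eta * visual_dist x xi' eta') /
  (visual_dist x xi eta' * visual_dist x xi' eta).

Definition moebius (X Y : metricType R) (f : boundary X -> boundary Y) : Prop :=
  forall (x : X) (y : Y) (xi xi' eta eta' : boundary X),
    uniq [:: xi; xi'; eta; eta'] ->
    cross_ratio y (f xi) (f xi') (f eta) (f eta') =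
    cross_ratio x xi xi' eta eta'.

End Moebius.

Definition homeomorphism (S T : topologicalType) (f : S -> T) : Prop :=
  continuous f /\
  exists g : T -> S, [/\ cancel f g, cancel g f & continuous g].

Section Maximal.
Context {R : realType}.

Definition boundary_extension (X Y : metricType R) (F : X -> Y)
    (f : boundary X -> boundary Y) (z : compactification X) :
    compactification Y :=
  match z with
  | Interior x => Interior (F x)
  | Ideal xi => Ideal (f xi)
  end.

Definition good_hyperbolic_space (X : metricType R) : Prop :=
  [/\ proper_space X, geodesic_space X, geodesically_complete X,
      gromov_hyperbolic X & boundary_continuous X].

Definition maximal_hyperbolic_space (X : metricType R) : Prop :=
  good_hyperbolic_space X /\
  forall (Y : metricType R) (g : boundary Y -> boundary X),
    good_hyperbolic_space Y -> moebius g -> homeomorphism g ->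
    exists2 G : Y -> X,
      isometric_embedding G & continuous (boundary_extension G g).

End Maximal.

(* Main.v *)
Require Import Defs.
From mathcomp Require Import all_boot all_order all_algebra.
From mathcomp Require Import all_classical all_reals all_analysis.
From mathcomp Require Import lra.

(** The maximality of [Y] applied to [f], and that of [X] applied to the
    inverse [g] of [f], give isometric embeddings [F : X -> Y] and
    [G : Y -> X] extending [f] and [g].  The point is that [G \o F] and
    [F \o G] are identities, so that [F] is onto.  Both are isometric
    self-embeddings inducing the identity at infinity, and such an embedding
    [H] is the identity ([isometric_embedding_ideal_id]), for two reasons.

    First, the Gromov products at infinity based at [x] and at [H x] agree:
    the products at [x] of two points running to infinity along rays equal
    the products at [H x] of their images, which run to the same ideal points.

    Second, these products at infinity determine the base point
    ([gromov_product_basepoint_inj]).  Take a complete geodesic through [x]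
    and [y], with ends [xi+] and [xi-], and a third ideal point [eta].  Up to a
    factor 2, the products of [xi+] and [eta] based at [x] and [y] differ by
    [B xi+ + B eta], where [B] is the Busemann cocycle of [x] and [y]; likewise
    for [xi-].  If both differences vanish, then [B xi+ = B xi-]; but
    [B xi+ = d(x, y)] and [B xi- = - d(x, y)], whence [x = y].  Hyperbolicity
    enters to make these products finite ([gromov_extension_fin_num]). *)

Set Implicit Arguments.
Unset Strict Implicit.
Unset Printing Implicit Defensive.

Import Order.TTheory GRing.Theory Num.Theory.
Import numFieldNormedType.Exports.

Local Open Scope ring_scope.
Local Open Scope classical_set_scope.
Local Open Scope quotient_scope.

Section GromovProduct.
Context {R : realType}.
Implicit Types X Y : metricType R.

Lemma mdist_ray X (a : ray X) (s t : R) :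
  0 <= s -> s <= t -> mdist (a s) (a t) = t - s.
Proof.
move=> s0 st.
rewrite ray_isometric/= ?in_itv/= ?andbT//; last exact: le_trans st.
by rewrite distrC ger0_norm ?subr_ge0.
Qed.

Lemma gromov_product_ray_ge X (x : X) (a : ray X) (s t : R) :
  0 <= s -> s <= t -> s - mdist x (a 0) <= gromov_product x (a s) (a t).
Proof.
move=> s0 st; rewrite /gromov_product (mdist_ray a s0 st).
have := metric_triangle (a 0) x (a s); have := metric_triangle (a 0) x (a t).
rewrite (mdist_ray a (lexx 0) s0) (mdist_ray a (lexx 0) (le_trans s0 st)).
rewrite (metric_sym (a 0) x); lra.
Qed.

Lemma isometric_embedding_gromov_product X Y (F : X -> Y) (x y z : X) :
  isometric_embedding F ->
  gromov_product (F x) (F y) (F z) = gromov_product x y z.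
Proof. by move=> FI; rewrite /gromov_product !FI. Qed.

Lemma cvg_ray_ideal X (a : ray X) :
  Interior (a t) @[t --> +oo] --> Ideal (\pi a : boundary X).
Proof.
move=> A; rewrite nbhsE => -[U [oU Ua] UA].
have [_ Uideal] : compactification_open U := oU.
have [r rU] := Uideal _ Ua (a 0).
rewrite nbhs_filterE /fmap /=; near=> t; apply: UA; apply: rU.
(* the ray [a] itself witnesses that its far points lie in the shadow *)
exists a => //.
near=> s.
have t0 : 0 <= t by near: t; apply: nbhs_pinfty_ge; exact: num_real.
have rt : r <= t by near: t; apply: nbhs_pinfty_ge; exact: num_real.
have ts : t <= s by near: s; apply: nbhs_pinfty_ge; exact: num_real.
have := gromov_product_ray_ge (a 0) a t0 ts.
rewrite mdistxx subr0 => /(le_trans rt).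
by rewrite /gromov_product (metric_sym (a t)) (addrC (mdist _ (a t))).
Unshelve. all: by end_near. Qed.
Arguments cvg_ray_ideal {X} a.

(** For large [t], four-point hyperbolicity along [a s], [a t], [b t], [b s]
    bounds the product of [a s] and [b s] below by [s] up to a constant; the
    distances from [x] to [a s] and [b s] being [s] up to a constant, [a s] and
    [b s] are then at bounded distance. *)
Lemma gromov_product_cvgy_asymptotic X (x : X) (a b : ray X) :
  gromov_hyperbolic X ->
  (gromov_product x (a t) (b t))%:E @[t --> +oo] --> +oo%E ->
  asymptotic a b.
Proof.
move=> [delta delta0 hyp] /cvgeyPge aby; apply/asboolP.
set p := mdist x (a 0); set q := mdist x (b 0).
(* [(a s|b s)_x >= s - p - q - 2 * delta], while [d(x, a s) <= p + s] and
   [d(x, b s) <= q + s] *)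
exists (3 * (p + q) + 4 * delta) => s s0.
have p0 : 0 <= p by exact: mdist_ge0.
have q0 : 0 <= q by exact: mdist_ge0.
suff [t [st abt]] : exists t, s <= t /\ s <= gromov_product x (a t) (b t).
  have bs := gromov_product_ray_ge x b s0 st.
  have as_ := gromov_product_ray_ge x a s0 st.
  have h1 : s - p - q - delta <= gromov_product x (a t) (b s).
    apply: le_trans (hyp x (a t) (b s) (b t)); rewrite lerD2r le_min.
    apply/andP; split; first lra.
    move: bs; rewrite /gromov_product (metric_sym (b t)) -/q; lra.
  have h2 : s - p - q - 2 * delta <= gromov_product x (a s) (b s).
    apply: le_trans (hyp x (a s) (b s) (a t)).
    rewrite (_ : _ - _ = s - p - q - delta - delta); last by lra.
    rewrite lerD2r le_min h1 andbT.
    move: as_; rewrite -/p; lra.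
  have := metric_triangle x (a 0) (a s).
  have := metric_triangle x (b 0) (b s).
  rewrite !(mdist_ray _ (lexx 0) s0) -/p -/q.
  move: h2; rewrite /gromov_product; lra.
near (pinfty_nbhs R) => t; exists t; split.
  by near: t; apply: nbhs_pinfty_ge; exact: num_real.
by rewrite -lee_fin; near: t; exact: aby.
Unshelve. all: by end_near. Qed.

Lemma gromov_extension_cvg X (x : X) Phi (a b : ray X) :
  gromov_extension x Phi ->
  (gromov_product x (a t) (b t))%:E @[t --> +oo] -->
    Phi (Ideal (\pi a), Ideal (\pi b)).
Proof.
move=> [Phix _ Phic].
under eq_fun do rewrite -Phix.
apply: (cvg_comp (fun t => (Interior (a t), Interior (b t))) Phi _ (Phic _)).
by apply: (cvg_pair (cvg_ray_ideal a) (cvg_ray_ideal b)).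
Qed.
Arguments gromov_extension_cvg {X x Phi} a b.

(** Distinct ideal points have a finite product, as rays along which the product
    is unbounded are asymptotic. *)
Lemma gromov_extension_fin_num X (x : X) Phi (a b : ray X) :
  gromov_hyperbolic X -> gromov_extension x Phi ->
  (\pi a : boundary X) <> \pi b ->
  Phi (Ideal (\pi a), Ideal (\pi b)) \is a fin_num.
Proof.
move=> hyp Phix ab; rewrite ge0_fin_numE; last by case: Phix.
rewrite ltey; apply/eqP => Phiy; apply: ab.
apply/eqmodP/(gromov_product_cvgy_asymptotic (x := x) hyp).
by rewrite -Phiy; exact: gromov_extension_cvg.
Qed.

(** Equality of the extended products at [x] and [y] makes the sum of the two
    Busemann functions of [x] and [y] vanish; finiteness is what allows the
    limits to be subtracted. *)
Lemma cvg_busemann_sum X (x y : X) Phi Psi (a b : ray X) :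
  gromov_hyperbolic X -> gromov_extension x Phi -> gromov_extension y Psi ->
  (\pi a : boundary X) <> \pi b ->
  Phi (Ideal (\pi a), Ideal (\pi b)) = Psi (Ideal (\pi a), Ideal (\pi b)) ->
  (mdist x (a t) - mdist y (a t)) + (mdist x (b t) - mdist y (b t))
    @[t --> +oo] --> (0 : R).
Proof.
move=> hyp Phix Psiy ab PhiPsi.
have /fineK Phif := gromov_extension_fin_num hyp Phix ab.
have := gromov_extension_cvg a b Phix; rewrite -Phif => /fine_cvg /= cx.
have := gromov_extension_cvg a b Psiy.
rewrite -PhiPsi -Phif => /fine_cvg /= cy.
rewrite -(mul0r 2) -(subrr (fine (Phi (Ideal (\pi a), Ideal (\pi b))))).
rewrite (_ : (fun t => _) = fun t =>
    (gromov_product x (a t) (b t) - gromov_product y (a t) (b t)) * 2).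
  by apply: cvgMr_tmp; exact: cvgB cx cy.
by apply/funext => t; rewrite /gromov_product; lra.
Qed.

Lemma isometric_on_half_line X (c : R -> X) (eps : R) :
  isometric_on setT c -> `|eps| = 1 ->
  isometric_on `[0, +oo[ (fun t => c (eps * t)).
Proof. by move=> cI e1 s t _ _; rewrite cI// -mulrBr normrM e1 mul1r. Qed.

(** The hypothesis on third points excludes the real line, on which the Gromov
    products at infinity do not depend on the base point. *)
Lemma gromov_product_basepoint_inj X (x y : X) Phi Psi :
  geodesic_space X -> geodesically_complete X -> gromov_hyperbolic X ->
  (forall xi xi' : boundary X, exists eta, eta <> xi /\ eta <> xi') ->
  gromov_extension x Phi -> gromov_extension y Psi ->
  (forall xi eta, Phi (Ideal xi, Ideal eta) = Psi (Ideal xi, Ideal eta)) ->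
  x = y.
Proof.
move=> geo cpl hyp third Phix Psiy PhiPsi.
have [c0 [c0I c00 c0d]] := geo x y; set d := mdist x y in c0I c0d.
have d0 : 0 <= d by exact: mdist_ge0.
have [c cI cc0] := cpl 0 d c0 d0 c0I.
have cx : c 0 = x by rewrite cc0 ?in_itv//= lexx d0.
have cy : c d = y by rewrite cc0 ?in_itv//= lexx d0.
pose a := Ray (isometric_on_half_line (eps := 1) cI (normr1 R)).
pose b := Ray (isometric_on_half_line (eps := -1) cI (normrN1 R)).
have [eta [+ +]] := third (\pi a) (\pi b).
rewrite -(reprK eta); set e := repr eta => ea eb.
have ca := cvg_busemann_sum hyp Phix Psiy (nesym ea) (PhiPsi _ _).
have cb := cvg_busemann_sum hyp Phix Psiy (nesym eb) (PhiPsi _ _).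
have c2d : (mdist x (a t) - mdist y (a t)) + (mdist x (e t) - mdist y (e t)) -
    ((mdist x (b t) - mdist y (b t)) + (mdist x (e t) - mdist y (e t)))
    @[t --> +oo] --> 2 * d.
  (* beyond [y], [x] is farther than [y] by [d] along [a], and nearer by [d]
     along [b]; the terms in [e] cancel *)
  apply: cvg_near_cst; near=> t.
  have dt : d <= t by near: t; apply: nbhs_pinfty_ge; exact: num_real.
  have t0 := le_trans d0 dt.
  rewrite /= -cx -cy !cI// !sub0r mul1r mulN1r opprK !normrN ger0_norm//.
  rewrite ler0_norm ?subr_le0// ger0_norm ?addr_ge0//; lra.
have d2 : 2 * d = 0 - 0 by apply: (cvg_unique _ c2d (cvgB ca cb)).
by apply: mdist_positivity; rewrite -/d; lra.
Unshelve. all: by end_near. Qed.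

Lemma isometric_embedding_ideal_id X (H : X -> X) :
  good_hyperbolic_space X ->
  (forall xi xi' : boundary X, exists eta, eta <> xi /\ eta <> xi') ->
  isometric_embedding H -> continuous (boundary_extension H idfun) ->
  H =1 id.
Proof.
move=> [_ geo cpl hyp bc] third HI Hc x; apply/esym.
have [Phi Phix] := bc x; have [Psi PsiHx] := bc (H x).
apply: (gromov_product_basepoint_inj geo cpl hyp third Phix PsiHx) => xi eta.
rewrite -(reprK xi) -(reprK eta); move: (repr xi) (repr eta) => a b.
have [Psie _ Psic] := PsiHx.
have HC (r : ray X) :
    Interior (H (r t)) @[t --> +oo] --> Ideal (\pi r : boundary X).
  exact: cvg_comp (cvg_ray_ideal r) (Hc _).
have cPsi : (gromov_product x (a t) (b t))%:E @[t --> +oo] -->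
    Psi (Ideal (\pi a), Ideal (\pi b)).
  under eq_fun do rewrite -(isometric_embedding_gromov_product _ _ _ HI) -Psie.
  apply: (cvg_comp (fun t => (Interior (H (a t)), Interior (H (b t)))) Psi _
    (Psic _)).
  by apply: (cvg_pair (HC _) (HC _)).
exact: cvg_unique (gromov_extension_cvg _ _ Phix) cPsi.
Qed.

Lemma moebius_inverse X Y (f : boundary X -> boundary Y) g :
  cancel g f -> moebius f -> moebius g.
Proof.
move=> gK fM y x xi xi' eta eta' u.
rewrite -(fM x y) ?gK//.
by rewrite -(map_inj_uniq (can_inj gK)) in u *.
Qed.

End GromovProduct.

Local Open Scope card_scope.

Lemma card_gt2_third (T : Type) (n : nat) (a b : T) :
  (2 < n)%N -> `I_n #<= [set: T] -> exists c, c <> a /\ c <> b.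
Proof.
move=> n2 cardn; apply: contrapT => nc.
have sub : [set: T] `<=` [set a; b].
  move=> c _; apply: contrapT => cab; apply: nc; exists c.
  by split=> E; apply: cab; [left|right].
suff : `I_n #<= `I_2 by rewrite card_le_II leqNgt n2.
apply: card_le_trans cardn _; apply: card_le_trans (subset_card_le sub) _.
have -> : [set a; b] = (fun n => if n is 0%N then a else b) @` `I_2.
  apply/seteqP; split=> [_ [->|->]|_ [[|k] _ <-]].
  - by exists 0%N.
  - by exists 1%N.
  - by left.
  - by right.
exact: card_image_le.
Qed.

Theorem theorem1p5 (R : realType) (X Y : metricType R)
    (hX : maximal_hyperbolic_space X) (hY : maximal_hyperbolic_space Y)
    (cardX : `I_4 #<= [set: boundary X]) (cardY : `I_4 #<= [set: boundary Y])
    (f : boundary X -> boundary Y) (fM : moebius f) (fH : homeomorphism f) :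
  exists F : X -> Y,
    [/\ isometric_embedding F, bijective F & continuous (boundary_extension F f)].
Proof.
have [goodX maxX] := hX; have [goodY maxY] := hY.
have [fC [g [fK gK gC]]] := fH.
have gH : homeomorphism g by split=> //; exists f.
have [F FI FC] := maxY X f goodX fM fH.
have [G GI GC] := maxX Y g goodY (moebius_inverse gK fM) gH.
exists F; split => //; exists G.
- apply: (isometric_embedding_ideal_id (H := G \o F) goodX).
  + by move=> xi xi'; exact: (card_gt2_third (n := 4)).
  + by move=> x x'; rewrite /= GI FI.
  + have -> : boundary_extension (G \o F) idfun =
        boundary_extension G g \o boundary_extension F f.
      by apply/funext => -[x|xi] //=; rewrite fK.
    by move=> z; apply: continuous_comp; [exact: FC|exact: GC].
- apply: (isometric_embedding_ideal_id (H := F \o G) goodY).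
  + by move=> xi xi'; exact: (card_gt2_third (n := 4)).
  + by move=> y y'; rewrite /= FI GI.
  + have -> : boundary_extension (F \o G) idfun =
        boundary_extension F f \o boundary_extension G g.
      by apply/funext => -[y|eta] //=; rewrite gK.
    by move=> z; apply: continuous_comp; [exact: GC|exact: FC].
Qed.
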